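(* Let $f=\frac1n\sum_{i=1}^n f_i$ with $f_i:\mathbb{R}^d\to\mathbb{R}$ differentiable (not necessarily convex). Suppose $f$ is $L$-smooth, each $f_i$ is $L_i$-smooth, there exist $f^*,f_1^*,\dots,f_n^*\in\mathbb{R}$ with $f(x)\ge f^*$ and $f_i(x)\ge f_i^*$ for all $x\in\mathbb{R}^d$ and all $i\in\{1,\dots,n\}$, and there exists $D>0$ such that $$\frac1n\sum_{i=1}^n\|\nabla f_i(x)\|^2\le D\|\nabla f(x)\|^2\qquad\text{for all }x\in\mathbb{R}^d.$$ Put $\Delta_0:=f(x^0)-f^*$. Let $\varepsilon>0$. Consider the algorithm EF21-P + DCGD (described in the context) with compressors $\mathcal{C}_i^D\in\mathbb{U}(\omega)$, $\mathcal{C}^P\in\mathbb{B}(\alpha)$, and choose $x^0=w^0$ and $$\gamma=\min\left\{\frac{\alpha}{8L},\ \frac{n}{4D\omega L}\right\}.$$ If the number of iterations satisfies $$T\ge\frac{48\Delta_0L}{\varepsilon}\max\left\{\frac8\alpha,\ \frac{4D\omega}{n}\right\},$$ then $$\min_{0\le t\le T-1}\mathrm{E}\left[\|\nabla f(x^t)\|^2\right]\le\varepsilon .$$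
   Context: $\|\cdot\|$ is the Euclidean norm. A function $\varphi$ is $L$-smooth if it is differentiable with $\|\nabla \varphi(x)-\nabla \varphi(y)\|\le L\|x-y\|$ for all $x,y\in\mathbb{R}^d$; the constants $L$ and $L_i$ denote the smallest such numbers for $f$ and $f_i$. Fractions with zero denominator in the stepsize formula are read as $+\infty$. Compressors. For $\alpha\in(0,1]$, $\mathbb{B}(\alpha)$ is the set of (possibly) stochastic mappings $\mathcal{C}:\mathbb{R}^d\to\mathbb{R}^d$ with $\mathrm{E}[\|\mathcal{C}(x)-x\|^2]\le(1-\alpha)\|x\|^2$ for all $x\in\mathbb{R}^d$. For $\omega\ge0$, $\mathbb{U}(\omega)$ is the set of stochastic mappings $\mathcal{C}:\mathbb{R}^d\to\mathbb{R}^d$ with $\mathrm{E}[\mathcal{C}(x)]=x$ and $\mathrm{E}[\|\mathcal{C}(x)-x\|^2]\le\omega\|x\|^2$ for all $x\in\mathbb{R}^d$. Algorithm EF21-P + DCGD. Parameters: learning rate $\gamma>0$, initial iterate $x^0\in\mathbb{R}^d$, initial iterate shift $w^0=x^0$. For $t=0,1,\dots,T-1$: $g_i^t=\mathcal{C}_i^D(\nabla f_i(w^t))$ for $i=1,\dots,n$; $g^t=\frac1n\sum_{i=1}^n g_i^t$; $x^{t+1}=x^t-\gamma g^t$; $w^{t+1}=w^t+\mathcal{C}^P(x^{t+1}-w^t)$. *)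

(* Defs.v *)
From HB Require Import structures.
From mathcomp Require Import all_boot all_order all_algebra.
From mathcomp Require Import all_classical all_reals all_analysis.

Set Implicit Arguments.
Unset Strict Implicit.
Unset Printing Implicit Defensive.

Import Order.TTheory GRing.Theory Num.Theory.
Import numFieldNormedType.Exports.

Local Open Scope classical_set_scope.
Local Open Scope ring_scope.

(* The library norm `|x| on row vectors is the sup norm, hence this one. The
   two are equivalent, so the library topology and differentiability apply. *)
Definition enorm (R : realType) (d : nat) (x : 'rV[R]_d) : R :=
  Num.sqrt (\sum_i x 0 i ^+ 2).

Definition grad (R : realType) (d : nat) (f : 'rV[R]_d -> R) (x : 'rV[R]_d) :
    'rV[R]_d :=
  \row_i 'D_(delta_mx 0 i) f x.

Definition smooth (R : realType) (d : nat) (L : R) (f : 'rV[R]_d -> R) : Prop :=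
  (forall x, differentiable f x) /\
  (forall x y, enorm (grad f x - grad f y) <= L * enorm (x - y)).

(* Nonnegativity only matters for d = 0, where every real is a Lipschitz
   constant and there would be no smallest one. *)
Definition smoothness_constant (R : realType) (d : nat) (f : 'rV[R]_d -> R)
    (L : R) : Prop :=
  [/\ 0 <= L, smooth L f & forall L', 0 <= L' -> smooth L' f -> L <= L'].

Definition average (R : realType) (d n : nat) (f_ : 'I_n -> 'rV[R]_d -> R) :
    'rV[R]_d -> R :=
  fun x => n%:R^-1 * \sum_(i < n) f_ i x.

Definition borel_rV (R : realType) (d : nat) :=
  g_sigma_algebraType (@open 'rV[R]_d).

(* A stochastic mapping C : R^d -> R^d is a jointly measurable function of a
   random seed and of the argument; an expectation over C is an integral
   against the law of the seed. Seed spaces may differ between mappings, and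
   a deterministic mapping is one that ignores its seed. *)
Record stoch_map (R : realType) (d : nat) := StochMap {
  seed_disp : measure_display;
  seed : measurableType seed_disp;
  seed_law : probability seed R;
  stoch_fun :> seed -> 'rV[R]_d -> 'rV[R]_d;
  stoch_fun_measurable :
    measurable_fun [set: seed * borel_rV R d]
      (fun p => stoch_fun p.1 p.2 : borel_rV R d) }.

Definition biased_compressor (R : realType) (d : nat) (alpha : R)
    (C : stoch_map R d) : Prop :=
  forall x : 'rV[R]_d,
    ('E_(seed_law C)[fun s => (enorm (C s x - x) ^+ 2)%R]
      <= ((1 - alpha) * enorm x ^+ 2)%:E)%E.

(* The expectation of a random vector is taken coordinatewise. *)
Definition unbiased_compressor (R : realType) (d : nat) (omega : R)
    (C : stoch_map R d) : Prop :=
  (forall (x : 'rV[R]_d) (j : 'I_d),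
    ('E_(seed_law C)[fun s => (C s x 0 j)%R] = (x 0 j)%:E)%E) /\
  (forall x : 'rV[R]_d,
    ('E_(seed_law C)[fun s => (enorm (C s x - x) ^+ 2)%R]
      <= (omega * enorm x ^+ 2)%:E)%E).

Definition mutually_independent (disp : measure_display)
    (Omega : measurableType disp) (R : realType) (P : probability Omega R)
    (I : eqType) (F : I -> set (set Omega)) : Prop :=
  forall (s : seq I) (E : I -> set Omega), uniq s ->
    (forall k, k \in s -> F k (E k)) ->
    P (\big[setI/setT]_(k <- s) E k) = (\prod_(k <- s) P (E k))%E.

(* Every call of a compressor uses a fresh seed: xiD i t is the seed of worker
   i's compressor at iteration t, and xiP t that of the server's. All of them
   are mutually independent and have the laws prescribed by the compressors. *)
Section Algorithm.

Context (R : realType) (d n : nat).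
Context (disp : measure_display) (Omega : measurableType disp).
Context (P : probability Omega R).
Context (CD : 'I_n -> stoch_map R d) (CP : stoch_map R d).
Context (xiD : forall i : 'I_n, nat -> {RV P >-> seed (CD i)}).
Context (xiP : nat -> {RV P >-> seed CP}).

Definition seed_events (k : 'I_n * nat + nat) : set (set Omega) :=
  match k with
  | inl (i, t) => preimage_set_system setT (xiD i t) measurable
  | inr t => preimage_set_system setT (xiP t) measurable
  end.

Definition fresh_seeds : Prop :=
  [/\ forall i t B, measurable B -> distribution P (xiD i t) B = seed_law (CD i) B,
      forall t B, measurable B -> distribution P (xiP t) B = seed_law CP B
    & mutually_independent P seed_events].

Context (f_ : 'I_n -> 'rV[R]_d -> R) (gamma : R) (x0 : 'rV[R]_d).

Fixpoint ef21p_dcgd (t : nat) (w : Omega) : 'rV[R]_d * 'rV[R]_d :=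
  if t is t'.+1 then
    let: (x, v) := ef21p_dcgd t' w in
    let g := n%:R^-1 *: \sum_(i < n) CD i (xiD i t' w) (grad (f_ i) v) in
    let x' := x - gamma *: g in
    (x', v + CP (xiP t' w) (x' - v))
  else (x0, x0).

Definition iterate (t : nat) (w : Omega) : 'rV[R]_d := (ef21p_dcgd t w).1.

End Algorithm.

Definition frac_oo (R : realType) (a b : R) : \bar R :=
  if b == 0 then +oo%E else (a / b)%:E.

(* A stepsize is a positive real number, so a prescribed value +oo (which
   happens only for L = 0) puts no restriction on it. *)
Definition stepsize (R : realType) (m : \bar R) (gamma : R) : Prop :=
  0 < gamma /\ (m = gamma%:E \/ m = +oo%E).

(* Main.v *)
(* One iteration is cut into micro-steps, each consuming one fresh seed: the
   workers are added one at a time to the descent step, then the server moves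
   the shift. Since a fresh seed is independent of everything before it, Tonelli
   integrates it out with the state frozen. The Lyapunov function is
   [f x - f* + (gamma L^2 / alpha) |w - x|^2]. Replacing [f] after the step by its
   quadratic upper bound makes the quantity to integrate a nonnegative quadratic
   polynomial in the compressed messages: unbiasedness kills the linear term, the
   quadratic one costs the variance [omega |grad f_i|^2], and everything stays
   nonnegative, so that no integrability of the iterates is ever needed. The
   Lipschitz bound on the gradient, the growth condition and Young's inequality
   then show that the expected Lyapunov function decreases by at least
   [gamma / 2 E |grad f (x^t)|^2] at each iteration; summing over [t < T] bounds
   the smallest of these expectations. If [L = 0] the gradient is a constant, and
   it vanishes because [f] is bounded below. *)
Require Import Defs.
From HB Require Import structures.
From mathcomp Require Import all_boot all_order all_algebra.
From mathcomp Require Import all_classical all_reals all_analysis.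
From mathcomp Require Import measurable_realfun.
From mathcomp Require Import ring lra.

Import Order.TTheory GRing.Theory Num.Theory.
Import numFieldNormedType.Exports.

Set Implicit Arguments.
Unset Strict Implicit.
Unset Printing Implicit Defensive.

Local Open Scope classical_set_scope.
Local Open Scope ring_scope.

(** * Borel sets of row vectors *)

Section borel_vectors.
Context (R : realType) (d : nat).

(** Balls of the library norm are boxes, so around each point of [U] a box with rational corners
    fits inside [U]. The index type is countable, which turns this into a countable union. *)
Lemma rV_open_bigcup_boxes (U : set 'rV[R]_d) : open U ->
  exists I : set ((rat * rat)%type ^ d)%type,
    U = \bigcup_(q in I) [set v | forall j, (ratr (q j).1 : R) < v 0 j < ratr (q j).2].
Proof.
move=> oU.
pose box (q : ((rat * rat)%type ^ d)%type) :=
  [set v : 'rV[R]_d | forall j, (ratr (q j).1 : R) < v 0 j < ratr (q j).2].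
exists [set q | box q `<=` U]; apply/seteqP; split=> [v Uv|v [q]]; last exact.
have /nbhs_ballP[e /= e0 eU] : nbhs v U by exact: open_nbhs_nbhs.
have lo j : exists q : rat, v 0 j - e < ratr q < v 0 j.
  have /rat_in_itvoo[q] : v 0 j - e < v 0 j by rewrite gtrBl.
  by rewrite in_itv /= => ?; exists q.
have hi j : exists q : rat, v 0 j < ratr q < v 0 j + e.
  have /rat_in_itvoo[q] : v 0 j < v 0 j + e by rewrite ltrDl.
  by rewrite in_itv /= => ?; exists q.
have [l lP] := choice lo; have [h hP] := choice hi.
exists [ffun j => (l j, h j)].
  move=> w wP; apply: eU; split => // i j; rewrite !ord1.
  have := wP j; rewrite ffunE /= => /andP[lw wh].
  have /andP[l1 l2] := lP j; have /andP[h1 h2] := hP j.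
  by rewrite /ball /= ltr_norml; apply/andP; split; lra.
move=> j; rewrite ffunE /=.
by have /andP[_ ->] := lP j; have /andP[-> _] := hP j.
Qed.

(** Open sets generate the Borel sets and are countable unions of boxes; the preimage of a box is a
    finite intersection of preimages of intervals under the coordinates. *)
Lemma measurable_fun_rV (disp : measure_display) (T : measurableType disp)
    (h : T -> borel_rV R d) :
  (forall j, measurable_fun [set: T] (fun t => (h t : 'rV[R]_d) 0 j)) ->
  measurable_fun [set: T] h.
Proof.
move=> mh; apply: (@measurability _ _ _ _ _ h (@open 'rV[R]_d)) => // _ [U oU <-].
rewrite setTI; have [I ->] := rV_open_bigcup_boxes oU.
(* Boxes outside [I] are replaced by the empty set, so that the union runs over the whole countable
   type. *)
rewrite preimage_bigcup bigcup_mkcond.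
apply: countable_bigcupT_measurable => [|q]; first exact: countableP.
case: ifPn => _; last exact: measurable0.
rewrite [X in measurable X](_ : _ =
  \big[setI/setT]_(j < d)
    ((fun t => (h t : 'rV[R]_d) 0 j) @^-1` `](ratr (q j).1), (ratr (q j).2)[)).
  by apply: bigsetI_measurable => j _; rewrite -[X in measurable X]setTI; exact: mh.
apply/seteqP; split=> [t tq|t].
  by rewrite -bigcap_seq => j _ /=; rewrite in_itv /=; exact: tq.
by rewrite -bigcap_seq => tq j; have /= := tq j (mem_index_enum j); rewrite in_itv.
Qed.

Lemma continuous_measurable_rV (f : 'rV[R]_d -> R) :
  continuous f -> measurable_fun [set: borel_rV R d] (f : borel_rV R d -> R).
Proof.
move=> cf; apply: (measurability _ (RGenOpens.measurableE R)).
move=> _ [_ [a [b ->]] <-].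
rewrite setTI; apply: sub_sigma_algebra.
by move/continuousP: cf; apply; exact: interval_open.
Qed.

Lemma measurable_rV_coord (j : 'I_d) :
  measurable_fun [set: borel_rV R d] (fun v : borel_rV R d => (v : 'rV[R]_d) 0 j).
Proof. by apply: continuous_measurable_rV; exact: coord_continuous. Qed.

Context (disp : measure_display) (T : measurableType disp).
Implicit Types u v : T -> borel_rV R d.

Lemma measurable_fun_coord u j : measurable_fun [set: T] u ->
  measurable_fun [set: T] (fun t => (u t : 'rV[R]_d) 0 j).
Proof. by move=> mu; exact: (measurableT_comp (measurable_rV_coord j) mu). Qed.

Lemma measurable_fun_addv u v :
  measurable_fun [set: T] u -> measurable_fun [set: T] v ->
  measurable_fun [set: T] (fun t => (u t : 'rV[R]_d) + v t : borel_rV R d).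
Proof.
move=> mu mv; apply: measurable_fun_rV => j.
under eq_fun do rewrite mxE.
by apply: measurable_funD; exact: measurable_fun_coord.
Qed.

Lemma measurable_fun_scalev (k : R) u :
  measurable_fun [set: T] u ->
  measurable_fun [set: T] (fun t => k *: (u t : 'rV[R]_d) : borel_rV R d).
Proof.
move=> mu; apply: measurable_fun_rV => j.
under eq_fun do rewrite mxE.
by apply: measurable_funM => //; exact: measurable_fun_coord.
Qed.

Lemma measurable_fun_subv u v :
  measurable_fun [set: T] u -> measurable_fun [set: T] v ->
  measurable_fun [set: T] (fun t => (u t : 'rV[R]_d) - v t : borel_rV R d).
Proof.
move=> mu mv; apply: measurable_fun_rV => j.
under eq_fun do rewrite !mxE.
by apply: measurable_funB; exact: measurable_fun_coord.
Qed.

Lemma measurable_fun_sumv (I : Type) (s : seq I) (h : I -> T -> borel_rV R d) :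
  (forall i, measurable_fun [set: T] (h i)) ->
  measurable_fun [set: T] (fun t => \sum_(i <- s) (h i t : 'rV[R]_d) : borel_rV R d).
Proof.
move=> mh; apply: measurable_fun_rV => j.
under eq_fun do rewrite summxE.
by apply: measurable_sum => i; exact: measurable_fun_coord.
Qed.

End borel_vectors.

(** * Fresh seeds *)

Section product_law.
Context (disp : measure_display) (Omega : measurableType disp).
Context (R : realType) (P : probability Omega R).
Context (I : eqType) (F : I -> set (set Omega)).

(* [M] depends only on the seeds with index in [U]: it is independent of every
   finite family of events of the other seeds. *)
Definition independent_outside (U : pred I) (dT : measure_display)
    (T : measurableType dT) (M : Omega -> T) : Prop :=
  forall (A : set T) (s : seq I) (E : I -> set Omega),
    measurable A -> uniq s -> {in s, forall k, ~~ U k} ->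
    (forall k, k \in s -> F k (E k)) ->
    P (M @^-1` A `&` \big[setI/setT]_(k <- s) E k) =
      (P (M @^-1` A) * \prod_(k <- s) P (E k))%E.

Hypothesis F_measurable : forall k A, F k A -> measurable A.

(** Start of the induction along the algorithm: the initial state is deterministic, so its preimages
    are empty or the whole space. *)
Lemma independent_outside_cst (dT : measure_display) (T : measurableType dT) (a : T) :
  mutually_independent P F -> independent_outside pred0 (fun=> a).
Proof.
move=> indep A s E mA us _ FE.
rewrite preimage_cst; case: ifPn => _.
  by rewrite setTI probability_setT mul1e; exact: indep.
by rewrite set0I measure0 mul0e.
Qed.

Context (U : pred I) (dX dY : measure_display).
Context (X : measurableType dX) (Y : measurableType dY).
Context (M : {RV P >-> X}) (xi : {RV P >-> Y}) (k0 : I).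
Hypothesis M_indep : independent_outside U M.
Hypothesis k0_fresh : ~~ U k0.
Hypothesis xi_k0 : forall B, measurable B -> F k0 (xi @^-1` B).


(** Both sides are finite measures in [C] that agree on rectangles, an intersection-stable class
    generating the product sigma-algebra. Keeping the trace on events of other seeds, instead of the
    bare joint law, is what lets independence survive a step. *)
Lemma pair_law_trace (s : seq I) (E : I -> set Omega) (C : set (X * Y)) :
  measurable C -> uniq s -> {in s, forall k, ~~ (U k || (k == k0))} ->
  (forall k, k \in s -> F k (E k)) ->
  P ((fun w => (M w, xi w)) @^-1` C `&` \big[setI/setT]_(k <- s) E k) =
    (\prod_(k <- s) P (E k) * (distribution P M \x distribution P xi)%E C)%E.
Proof.
move=> mC us sU FE.
set D := \big[setI/setT]_(k <- s) E k.
have mD : measurable D.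
  by rewrite /D big_seq; apply: bigsetI_measurable => k /FE; exact: F_measurable.
set c := (\prod_(k <- s) P (E k))%E.
have c_ge0 : (0 <= c)%E by apply: prode_ge0.
have c_fin : c \is a fin_num.
  rewrite /c big_seq; apply: prode_fin_num => k /FE/F_measurable mE.
  exact: fin_num_measure.
pose r : {nonneg R} := NngNum (fine_ge0 c_ge0).
have cE : c = (r%:num)%:E by rewrite /= fineK.
have mMxi : measurable_fun [set: Omega] (fun w => (M w, xi w)).
  exact: measurable_fun_pair.
pose m1 mf : {measure set (X * Y) -> \bar R} :=
  measure_function_pushforward__canonical__measure_function_Measure
    (mrestr P mD) (f := fun w => (M w, xi w)) mf.
pose m2 : {measure set (X * Y) -> \bar R} :=
  mscale r (distribution P M \x distribution P xi)%E.
transitivity (m1 mMxi C); first by [].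
transitivity (m2 C); last by rewrite /m2 /= /mscale /= -cE.
pose CT := [set C : set (X * Y) |
  exists A, measurable A /\ exists B, measurable B /\ C = A `*` B].
apply: (measure_unique CT (fun=> setT)) => //.
- rewrite measurable_prod_measurableType //; congr (<<s _ >>).
  rewrite predeqE; split => [[A mA [B mB <-]]|[A [mA [B [mB ->]]]]].
    by exists A; split => //; exists B.
  by exists A => //; exists B.
- move=> /= _ _ [X1 [mX1 [X2 [mX2 ->]]]] [Y1 [mY1 [Y2 [mY2 ->]]]].
  rewrite -setXI; exists (X1 `&` Y1); split; first exact: measurableI.
  by exists (X2 `&` Y2); split => //; exact: measurableI.
- by move=> _; exists setT; split => //; exists setT; split => //; rewrite setXTT.
- by rewrite bigcup_const.
- move=> _ [A [mA [B [mB ->]]]].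
  rewrite /m2 /= /mscale /= -cE product_measure1E// /m1 /= /pushforward /mrestr /=.
  (* Since [k0] is not in [s], the event on [xi] can join the family as its member of index [k0];
     independence of [M] then applies to [k0 :: s]. *)
  have k0s : k0 \notin s by apply/negP => /sU; rewrite eqxx orbT.
  pose E' k := if k == k0 then xi @^-1` B else E k.
  have E's k : k \in s -> E' k = E k.
    by rewrite /E'; case: eqVneq => // -> ks; rewrite ks in k0s.
  have uk0s : uniq (k0 :: s) by rewrite /= k0s.
  have k0sU : {in k0 :: s, forall k, ~~ U k}.
    by move=> k; rewrite inE => /predU1P[->//|/sU]; rewrite negb_or => /andP[].
  have FE' k : k \in k0 :: s -> F k (E' k).
    rewrite inE => /predU1P[->|ks]; first by rewrite /E' eqxx; exact: xi_k0.
    by rewrite E's//; exact: FE.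
  have := M_indep mA uk0s k0sU FE'.
  rewrite !big_cons (eq_big_seq E E's).
  rewrite (eq_big_seq (fun k => P (E k))) => [|k /E's ->//].
  have E'k0 : E' k0 = xi @^-1` B by rewrite /E' eqxx.
  rewrite E'k0 setIA => ->.
  by rewrite /distribution /pushforward [RHS]muleC -muleA.
- move=> _; rewrite /m1 /= /pushforward /mrestr /=.
  by rewrite preimage_setT setTI -ge0_fin_numE//; exact: fin_num_measure.
Qed.

(** The trace identity is used twice: the empty family identifies the product measure of the event
    with its probability, and the family [s] then gives the factorisation. *)
Lemma independent_outside_step (dZ : measure_display) (Z : measurableType dZ)
    (phi : X * Y -> Z) : measurable_fun [set: X * Y] phi ->
  independent_outside (predU1 k0 U) (fun w => phi (M w, xi w)).
Proof.
move=> mphi A s E mA us sU FE.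
have mC : measurable (phi @^-1` A) by rewrite -[X in measurable X]setTI; exact: mphi.
have sU' : {in s, forall k, ~~ (U k || (k == k0))}.
  by move=> k /sU; rewrite /= orbC.
have := @pair_law_trace [::] E _ mC isT; rewrite !big_nil setIT mul1e => h0.
by rewrite (pair_law_trace mC us sU' FE) h0// muleC.
Qed.

(** For the empty family the trace identity says that the joint law is the product law; Tonelli then
    applies to the nonnegative [h]. *)
Lemma integral_fresh_seed (h : X * Y -> \bar R) :
  measurable_fun [set: X * Y] h -> (forall z, 0 <= h z)%E ->
  (\int[P]_w h (M w, xi w) =
   \int[P]_w \int[distribution P xi]_y h (M w, y))%E.
Proof.
move=> mh h0.
have mMxi : measurable_fun [set: Omega] (fun w => (M w, xi w)).
  exact: measurable_fun_pair.
pose MX : {RV P >-> (X * Y)%type} := HB.pack (fun w => (M w, xi w))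
  (isMeasurableFun.Build _ _ _ _ _ mMxi).
rewrite -[LHS](@ge0_integral_distribution _ _ _ _ _ P MX h)//.
transitivity (\int[distribution P M \x distribution P xi]_z h z)%E.
  apply: eq_measure_integral => /= C mC _.
  have := @pair_law_trace [::] (fun=> setT) _ mC isT.
  by rewrite !big_nil setIT mul1e => <-.
rewrite fubini_tonelli1//.
rewrite ge0_integral_distribution//.
- exact: measurable_fun_fubini_tonelli_F.
- by move=> x; apply: integral_ge0.
Qed.

(** Stands in for conditioning on the past: a bound on the average over the seed, proved at each
    frozen state, passes to the expectation. *)
Lemma le_integral_fresh_seed (law : probability Y R) (h : X * Y -> \bar R)
    (g : X -> \bar R) :
  (forall B, measurable B -> distribution P xi B = law B) ->
  measurable_fun [set: X * Y] h -> (forall z, 0 <= h z)%E ->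
  measurable_fun [set: X] g ->
  (forall x, \int[law]_y h (x, y) <= g x)%E ->
  (\int[P]_w h (M w, xi w) <= \int[P]_w g (M w))%E.
Proof.
move=> lawE mh h0 mg hg; rewrite integral_fresh_seed//.
have inner w : (\int[distribution P xi]_y h (M w, y) =
                \int[law]_y h (M w, y))%E.
  by apply: eq_measure_integral => B mB _; exact: lawE.
apply: ge0_le_integral => //.
- by move=> w _; apply: integral_ge0.
- have mF := measurable_fun_fubini_tonelli_F (m2 := distribution P xi) _ mh h0.
  exact: (measurableT_comp mF (@measurable_funPT _ _ _ _ M)).
- exact: (measurableT_comp mg (@measurable_funPT _ _ _ _ M)).
- by move=> w _; rewrite inner.
Qed.

End product_law.

(** * Gradients of smooth functions *)

Section euclidean.
Context (R : realType) (d : nat).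
Implicit Types (u v w : 'rV[R]_d) (k : R).

Definition dot u v : R := \sum_i u 0 i * v 0 i.

Lemma dotC u v : dot u v = dot v u.
Proof. by apply: eq_bigr => i _; rewrite mulrC. Qed.

Lemma dotDl u v w : dot (u + v) w = dot u w + dot v w.
Proof. by rewrite -big_split; apply: eq_bigr => i _; rewrite mxE mulrDl. Qed.

Lemma dotZl k u v : dot (k *: u) v = k * dot u v.
Proof. by rewrite big_distrr; apply: eq_bigr => i _; rewrite mxE /= mulrA. Qed.

Lemma dotNl u v : dot (- u) v = - dot u v.
Proof. by rewrite -scaleN1r dotZl mulN1r. Qed.

Lemma dotDr u v w : dot u (v + w) = dot u v + dot u w.
Proof. by rewrite ![dot u _]dotC dotDl. Qed.

Lemma dotZr k u v : dot u (k *: v) = k * dot u v.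
Proof. by rewrite ![dot u _]dotC dotZl. Qed.

Lemma dotNr u v : dot u (- v) = - dot u v.
Proof. by rewrite ![dot u _]dotC dotNl. Qed.

Definition dotE := (dotDl, dotDr, dotNl, dotNr, dotZl, dotZr).

Lemma dotvv_ge0 u : 0 <= dot u u.
Proof. by apply: sumr_ge0 => i _; rewrite -expr2 sqr_ge0. Qed.

Lemma dotvv_eq0 u : dot u u = 0 -> u = 0.
Proof.
move=> /psumr_eq0P u0; apply/rowP => i; rewrite mxE.
apply/eqP; rewrite -sqrf_eq0 expr2; apply/eqP; apply: u0 => // j _.
by rewrite -expr2 sqr_ge0.
Qed.

Lemma enorm_sqr u : enorm u ^+ 2 = dot u u.
Proof.
rewrite /enorm sqr_sqrtr; last by apply: sumr_ge0 => i _; rewrite sqr_ge0.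
by apply: eq_bigr => i _; rewrite expr2.
Qed.

Lemma enorm_ge0 u : 0 <= enorm u.
Proof. exact: sqrtr_ge0. Qed.

(** A form of Cauchy-Schwarz: for [k > 0], expand the squared norm of [u - k *: v] and divide by
    [k]; for [k = 0] the vector [u] vanishes. *)
Lemma dot_le_enorm u v k : 0 <= k -> enorm u <= k * enorm v ->
  dot u v <= k * enorm v ^+ 2.
Proof.
move=> k0 uv.
have uu : dot u u <= k ^+ 2 * dot v v.
  rewrite -!enorm_sqr -exprMn; apply: lerXn2r => //; rewrite nnegrE ?enorm_ge0//.
  by rewrite mulr_ge0// enorm_ge0.
rewrite enorm_sqr.
move: k0; rewrite le_eqVlt => /predU1P[k0|k0].
  have -> : u = 0.
    apply: dotvv_eq0; apply/eqP; rewrite eq_le dotvv_ge0 andbT.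
    by rewrite (le_trans uu)// -k0 expr0n mul0r.
  by rewrite -[in dot _ _](scale0r v) dotZl mul0r -k0 mul0r.
have := dotvv_ge0 (u - k *: v); rewrite !dotE [dot v u]dotC => h.
by rewrite -(ler_pM2l k0); lra.
Qed.

Lemma coord_le_norm u i : `|u 0 i| <= `|u|.
Proof.
rewrite {2}/Num.norm /= mx_normrE.
exact: (@le_bigmax _ _ _ _ (fun ij : 'I_1 * 'I_d => `|u ij.1 ij.2|) (0, i)).
Qed.

Lemma coord_le_enorm u i : `|u 0 i| <= enorm u.
Proof.
rewrite -sqrtr_sqr ler_wsqrtr// (bigD1 i)//= lerDl.
by apply: sumr_ge0 => j _; rewrite sqr_ge0.
Qed.

Lemma enorm_le_norm u : enorm u <= d%:R * `|u|.
Proof.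
have du0 : 0 <= d%:R * `|u| by rewrite mulr_ge0.
rewrite -(ger0_norm du0) -sqrtr_sqr ler_wsqrtr//.
apply: (@le_trans _ _ (\sum_(i < d) `|u| ^+ 2)).
  apply: ler_sum => i _; rewrite -real_normK ?num_real//.
  by rewrite lerXn2r ?nnegrE// coord_le_norm.
rewrite sumr_const cardT size_enum_ord exprMn -[leLHS]mulr_natl.
rewrite ler_wpM2r ?sqr_ge0// expr2 -natrM ler_nat.
by case: (d) => // k; rewrite leq_pmulr.
Qed.

End euclidean.

Section gradient.
Context (R : realType) (d : nat).
Implicit Types (f : 'rV[R]_d -> R) (x y u v : 'rV[R]_d) (L : R).

Lemma derive_dot f x v : differentiable f x -> 'D_v f x = dot (grad f x) v.
Proof.
move=> df; rewrite deriveE// [in LHS](row_sum_delta v) linear_sum.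
apply: eq_bigr => i _; rewrite linearZ /= mxE deriveE// mulrC; congr (_ * _).
Qed.

Lemma is_derive_line f x u (t : R) : (forall z, differentiable f z) ->
  is_derive t (1 : R) (fun s : R => f (s *: u + x)) (dot (grad f (t *: u + x)) u).
Proof.
move=> df.
have dl : is_diff t (fun s : R => s *: u + x) (fun s : R => s *: u).
  by apply: is_diff_eq; rewrite addr0.
have df' : is_diff (t *: u + x) f ('d f (t *: u + x)) by exact: differentiableP.
have dc := @is_diff_comp _ _ _ _ _ _ _ _ _ dl df'.
have dfl : differentiable (f \o (fun s : R => s *: u + x)) t by exact: ex_diff.
apply: DeriveDef; first by apply/derivable1_diffP.
by rewrite deriveE// diff_val /= scale1r -deriveE// derive_dot.
Qed.

(** The mean value theorem on [[0, 1]] replaces integration of the gradient: [phi], the gap between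
    [f] and its quadratic bound along the segment, has a nonpositive derivative, so
    [phi 1 <= phi 0]. *)
Lemma smooth_upper_bound f L x y : 0 <= L -> smooth L f ->
  f y <= f x + dot (grad f x) (y - x) + L / 2 * enorm (y - x) ^+ 2.
Proof.
move=> L0 [df lip]; set u := y - x.
pose K := enorm u ^+ 2.
pose phi (s : R) := f (s *: u + x) - (s * dot (grad f x) u + L / 2 * K * s ^+ 2).
pose dphi (s : R) :=
  dot (grad f (s *: u + x)) u - (dot (grad f x) u + L * K * s).
have dphiP (s : R) : is_derive s (1 : R) phi (dphi s).
  rewrite /phi /dphi; apply: is_deriveB; first exact: is_derive_line.
  have : is_derive s (1 : R)
    (dot (grad f x) u \*: @id R + (L / 2 * K) \*: (@id R) ^+ 2)
    (dot (grad f x) u *: 1 + (L / 2 * K) *: ((2%:R * s ^+ 1) *: 1)).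
    by apply: is_deriveD; apply: is_deriveZ.
  rewrite (_ : _ + _ = fun r => r * dot (grad f x) u + L / 2 * K * r ^+ 2).
    move=> h; apply: is_derive_eq.
    by rewrite /GRing.scale /= expr1 !mulr1; lra.
  by apply/funext => r; rewrite /= [r * _]mulrC.
have cphi : {within `[0, 1], continuous phi}.
  apply: derivable_within_continuous => s _; exact: ex_derive.
have [c c01] := @MVT _ phi dphi 0 1 ltr01 (fun s _ => dphiP s) cphi.
have c0 : 0 <= c by move: c01; rewrite in_itv /= => /andP[/ltW].
have dphi_le0 : dphi c <= 0.
  (* The points [c *: u + x] and [x] differ by [c *: u], so their gradients differ in norm by at
     most [L * c * enorm u]. *)
  rewrite /dphi -/K subr_le0 -lerBlDl -dotNl -dotDl.
  rewrite [L * K * c]mulrAC; apply: dot_le_enorm; first exact: mulr_ge0.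
  apply: le_trans (lip _ _) _.
  rewrite addrK -mulrA ler_wpM2l// /enorm.
  rewrite (_ : \sum_i _ = c ^+ 2 * \sum_i u 0 i ^+ 2).
    by rewrite sqrtrM ?sqr_ge0// sqrtr_sqr ger0_norm.
  by rewrite big_distrr; apply: eq_bigr => i _; rewrite mxE exprMn.
rewrite subr0 mulr1 /phi scale1r scale0r add0r subrK -/K => e.
by lra.
Qed.

Lemma smooth_measurable_grad f L : 0 <= L -> smooth L f ->
  measurable_fun [set: borel_rV R d] (grad f : borel_rV R d -> borel_rV R d).
Proof.
move=> L0 [_ lip]; apply: measurable_fun_rV => j.
apply: continuous_measurable_rV => x.
apply/(@cvgrPdist_le _ _ _ (nbhs x) (nbhs_filter x)) => e e0.
(* Adding 1 keeps the divisor positive when [L] or [d] is zero. *)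
have K0 : 0 < L * d%:R + 1 by rewrite ltr_wpDl// mulr_ge0.
near=> y.
have -> : grad f x 0 j - grad f y 0 j = (grad f x - grad f y) 0 j by rewrite !mxE.
apply: le_trans (coord_le_enorm _ _) _; apply: le_trans (lip _ _) _.
apply: (@le_trans _ _ ((L * d%:R + 1) * `|x - y|)).
  rewrite mulrDl mul1r -mulrA; apply: ler_wpDr => //.
  by rewrite ler_wpM2l// enorm_le_norm.
rewrite mulrC -ler_pdivlMr//.
near: y; apply/nbhs_ballP; exists (e / (L * d%:R + 1)); first exact: divr_gt0.
by move=> z; rewrite -ball_normE /= => /ltW.
Unshelve. all: by end_near. Qed.

Lemma smooth_measurable f L : smooth L f ->
  measurable_fun [set: borel_rV R d] (f : borel_rV R d -> R).
Proof.
move=> [df _]; apply: continuous_measurable_rV => x.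
exact: differentiable_continuous.
Qed.

Lemma grad_average n (f_ : 'I_n -> 'rV[R]_d -> R) x :
  (forall i, differentiable (f_ i) x) ->
  grad (average f_) x = n%:R^-1 *: \sum_(i < n) grad (f_ i) x.
Proof.
move=> df; apply/rowP => j; rewrite !mxE summxE.
have -> : average f_ = n%:R^-1 \*: \sum_(i < n) f_ i.
  by apply/funext => y; rewrite /average /= fct_sumE.
have dj i : derivable (f_ i) x (delta_mx 0 j) by exact: diff_derivable.
rewrite deriveZ; last exact: derivable_sum.
by rewrite derive_sum//; congr (_ * _); apply: eq_bigr => i _; rewrite mxE.
Qed.

Lemma smooth0_bounded_grad f a x : smooth 0 f -> (forall y, a <= f y) ->
  grad f x = 0.
Proof.
move=> sf fa; apply: dotvv_eq0; apply/eqP; rewrite eq_le dotvv_ge0 andbT.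
set g := dot _ _; rewrite leNgt; apply/negP => g0.
(* With this step length the affine upper bound at [x - s *: grad f x] equals [a - 1], below the
   lower bound [a]. *)
pose s := (f x - a + 1) / g.
have := smooth_upper_bound x (x - s *: grad f x) (lexx 0) sf.
rewrite mul0r mul0r addr0 addrAC subrr add0r !dotE -/g /s divfK ?gt_eqF// => h.
by have := fa (x - s *: grad f x); rewrite /s; lra.
Qed.

End gradient.

(** * Moments of compressed vectors *)

Section compressor_moments.
Context (R : realType) (d : nat) (C : stoch_map R d).
Implicit Types (a g : 'rV[R]_d).

Lemma measurable_stoch_map a :
  measurable_fun [set: seed C] (fun s => C s a : borel_rV R d).
Proof.
have mp : measurable_fun [set: seed C] (fun s => (s, a : borel_rV R d)).
  exact: measurable_fun_pair.
exact: (measurableT_comp (@stoch_fun_measurable _ _ C) mp).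
Qed.

Let err a (s : seed C) : 'rV[R]_d := C s a - a.

Let measurable_err a j : measurable_fun [set: seed C] (fun s => err a s 0 j).
Proof.
apply: measurable_fun_coord; apply: measurable_fun_subv => //.
exact: measurable_stoch_map.
Qed.

Let measurable_err2 a : measurable_fun [set: seed C] (fun s => enorm (err a s) ^+ 2).
Proof.
under eq_fun do rewrite enorm_sqr.
by apply: measurable_sum => j; apply: measurable_funM.
Qed.

Let integral_const (k : R) : (\int[seed_law C]__ k%:E = k%:E)%E.
Proof.
rewrite -[RHS]mule1 -(probability_setT (seed_law C)).
exact: integral_cst.
Qed.

Lemma biased_second_moment alpha a (A B : R) : biased_compressor alpha C ->
  0 <= A -> 0 <= B ->
  (\int[seed_law C]_s (A + B * enorm (C s a - a) ^+ 2)%:E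
    <= (A + B * ((1 - alpha) * enorm a ^+ 2))%:E)%E.
Proof.
move=> /(_ a) + A0 B0; rewrite expectation.unlock => Cle.
under eq_integral do rewrite EFinD EFinM.
rewrite ge0_integralD//.
- rewrite integral_const ge0_integralZl_EFin//.
  + by rewrite EFinD leeD2l// EFinM lee_wpmul2l.
  + by move=> s _; rewrite lee_fin sqr_ge0.
  + by apply/measurable_EFinP; exact: measurable_err2.
- by move=> s _; rewrite -EFinM lee_fin mulr_ge0// sqr_ge0.
- by apply: measurable_funeM; apply/measurable_EFinP; exact: measurable_err2.
Qed.

(** The variance bound makes the error square integrable, hence integrable on a probability space.
    The integral may then be split whatever the sign of the linear term, whose mean is zero. *)
Lemma unbiased_second_moment omega a g (A B : R) : unbiased_compressor omega C ->
  0 <= B ->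
  (\int[seed_law C]_s (A + dot g (C s a - a) + B * enorm (C s a - a) ^+ 2)%:E
    <= (A + B * (omega * enorm a ^+ 2))%:E)%E.
Proof.
move=> [Cmean Cvar] B0.
have := Cvar a; rewrite expectation.unlock => Cle.
have int2 : (seed_law C).-integrable setT (EFin \o (fun s => enorm (err a s) ^+ 2)).
  apply/integrableP; split; first by apply/measurable_EFinP; exact: measurable_err2.
  under eq_integral do rewrite /= ger0_norm ?sqr_ge0//.
  by apply: le_lt_trans Cle _; rewrite ltry.
have intc (k : R) : (seed_law C).-integrable setT (EFin \o cst k).
  exact: finite_measure_integrable_cst.
have int1 j : (seed_law C).-integrable setT (EFin \o (fun s => err a s 0 j)).
  have int12 : (seed_law C).-integrable setT
      (EFin \o (fun s => 1 + enorm (err a s) ^+ 2)).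
    exact: (integrableD measurableT (intc 1) int2).
  apply: (le_integrable measurableT _ _ int12) => [|s _ /=].
    by apply/measurable_EFinP; exact: measurable_err.
  rewrite lee_fin [leRHS]ger0_norm; last by rewrite addr_ge0// sqr_ge0.
  (* The square of [enorm - 1] gives [enorm <= 1 + enorm ^+ 2], an integrable majorant of each
     coordinate. *)
  have := coord_le_enorm (err a s) j; have := sqr_ge0 (enorm (err a s) - 1).
  have := enorm_ge0 (err a s); nra.
have mean0 j : (\int[seed_law C]_s (err a s 0 j)%:E = 0)%E.
  have := Cmean a j; rewrite expectation.unlock.
  have -> : (\int[seed_law C]_s (C s a 0 j)%:E =
      \int[seed_law C]_s ((err a s 0 j)%:E + (a 0 j)%:E))%E.
    by apply: eq_integral => s _; rewrite /= -EFinD !mxE subrK.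
  rewrite (integralD measurableT (int1 j) (intc _)) integral_const => h.
  have : (\int[seed_law C]_s (err a s 0 j)%:E + (a 0 j)%:E - (a 0 j)%:E = 0)%E.
    by rewrite [X in (X - _)%E]h -EFinB subrr.
  by rewrite addeK.
have intg : (seed_law C).-integrable setT (fun s => (dot g (err a s))%:E).
  rewrite /dot; under eq_fun do rewrite -sumEFin.
  apply: integrable_sum => // j _; under eq_fun do rewrite EFinM.
  exact: (integrableZl measurableT (g 0 j) (int1 j)).
have meang : (\int[seed_law C]_s (dot g (err a s))%:E = 0)%E.
  rewrite /dot; under eq_integral do rewrite -sumEFin.
  rewrite integral_sum//.
    rewrite big1// => j _; under eq_integral do rewrite EFinM.
    by rewrite (integralZl measurableT (int1 j)) mean0 mule0.
  move=> j; under eq_fun do rewrite EFinM.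
  exact: (integrableZl measurableT (g 0 j) (int1 j)).
under eq_integral do rewrite EFinD EFinD EFinM.
have int2B := integrableZl measurableT B int2.
rewrite (integralD measurableT (integrableD measurableT (intc A) intg) int2B).
rewrite (integralD measurableT (intc A) intg) integral_const.
rewrite [X in (_ + X + _)%E]meang adde0 (integralZl measurableT int2).
by rewrite EFinD leeD2l// EFinM lee_wpmul2l.
Qed.

End compressor_moments.

(** * The Lyapunov argument *)

Lemma measurable_fun_dot (R : realType) (d : nat) (disp : measure_display)
    (T : measurableType disp) (u v : T -> borel_rV R d) :
  measurable_fun [set: T] u -> measurable_fun [set: T] v ->
  measurable_fun [set: T] (fun t => dot (u t) (v t)).
Proof.
move=> mu mv; apply: measurable_sum => j.
by apply: measurable_funM; exact: measurable_fun_coord.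
Qed.

Lemma measurable_fun_enorm2 (R : realType) (d : nat) (disp : measure_display)
    (T : measurableType disp) (u : T -> borel_rV R d) :
  measurable_fun [set: T] u -> measurable_fun [set: T] (fun t => enorm (u t) ^+ 2).
Proof.
by move=> mu; under eq_fun do rewrite enorm_sqr; exact: measurable_fun_dot.
Qed.

Lemma stepsize_ratio (R : realType) (gamma alpha L : R) : 0 < alpha ->
  gamma * (8 * L) <= alpha -> gamma / alpha * L <= 8^-1.
Proof. by move=> alpha0 h; rewrite mulrAC ler_pdivrMr//; lra. Qed.

Lemma variance_ratio (R : realType) (gamma D omega L n : R) : 0 < n ->
  gamma * (4 * D * omega * L) <= n -> gamma * L * (omega * D / n) <= 4^-1.
Proof. by move=> n0 h; rewrite mulrA ler_pdivrMr//; lra. Qed.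

(* The hypotheses are the Lipschitz bound, the variance bound and Young's
   inequality, in terms of the inner products of [g = grad f v], [a = grad f x]
   and [y = v - x]; [del = gamma / alpha] and [r = omega * D / n]. *)
Lemma lyapunov_decrease_scalar (R : realType) (alpha del L r V aa yy gg ag yg : R) :
  0 < alpha -> alpha <= 1 -> 0 < del -> 0 < L -> 0 <= r ->
  del * L <= 8^-1 -> alpha * del * L * r <= 4^-1 -> 0 <= yy -> 0 <= gg ->
  aa - 2 * ag + gg <= L ^+ 2 * yy ->
  V <= (L / 2 + del * L ^+ 2 * (1 - alpha)) * (alpha * del) ^+ 2 * r * gg ->
  0 <= yy - 4 * del * yg + 4 * del ^+ 2 * gg ->
  - (alpha * del) * ag + L / 2 * ((alpha * del) ^+ 2 * gg)
    + del * L ^+ 2 *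
      ((1 - alpha) * (yy + 2 * (alpha * del) * yg + (alpha * del) ^+ 2 * gg))
    + V + alpha * del / 2 * aa <= del * L ^+ 2 * yy.
Proof.
move=> a0 a1 d0 L0 r0 q8 w4 yy0 gg0 lip var young.
pose q := del * L; pose w := alpha * del * L * r.
have q0 : 0 <= q by rewrite mulr_ge0// ltW.
have w0 : 0 <= w by rewrite !mulr_ge0// ltW.
rewrite -/q in q8.
rewrite -/w in w4.
have b1 : 0 <= 1 - alpha by lra.
have ad0 : 0 <= alpha * del by rewrite mulr_ge0// ltW.
(* Half of this bounds [alpha * del * (aa / 2 - ag)] and leaves [- alpha * del / 2 * gg] to pay for
   all other [gg] terms. *)
have h1 : alpha * del * (aa - 2 * ag + gg) <= alpha * del * (L ^+ 2 * yy).
  exact: ler_wpM2l.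
have e1 : 0 <= del * L ^+ 2 * (1 - alpha) * alpha.
  by rewrite mulr_ge0 ?(ltW a0)// mulr_ge0// mulr_ge0 ?(ltW d0)// sqr_ge0.
(* Half of this absorbs the cross term in [yg]. The total coefficient of [yy] becomes
   [del * L ^+ 2 * (1 - alpha ^+ 2 / 2)], whence the slack [h4]. *)
have h2 := mulr_ge0 e1 young.
(* This is the total coefficient of [gg] divided by [alpha * del]; the bounds on [q] and [w] make it
   at most [- 1 / 4]. *)
have br : - 2^-1 + q * alpha / 2 + (w / 2 + q * (1 - alpha) * w)
    + q ^+ 2 * ((1 - alpha) * (2 + alpha)) <= 0.
  have t1 : q * alpha <= 8^-1 by nra.
  have t2 : q * (1 - alpha) * w <= 8^-1 * 4^-1.
    have : q * (1 - alpha) <= 8^-1 by nra.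
    by move=> ?; apply: ler_pM => //; rewrite mulr_ge0.
  have t3 : q ^+ 2 * ((1 - alpha) * (2 + alpha)) <= 8^-1 ^+ 2 * 2.
    apply: ler_pM; [exact: sqr_ge0|nra| |nra].
    by rewrite lerXn2r ?nnegrE.
  lra.
have h3 : alpha * del * gg * (- 2^-1 + q * alpha / 2 + (w / 2 + q * (1 - alpha) * w)
    + q ^+ 2 * ((1 - alpha) * (2 + alpha))) <= 0.
  by rewrite mulr_ge0_le0// mulr_ge0.
have h4 : 0 <= del * L ^+ 2 * alpha ^+ 2 * yy.
  by rewrite mulr_ge0// mulr_ge0 ?sqr_ge0// mulr_ge0 ?sqr_ge0// ltW.
rewrite /q /w in h3.
lra.
Qed.

Section lyapunov.
Context (R : realType) (d n : nat) (f_ : 'I_n -> 'rV[R]_d -> R).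
Context (fstar L D alpha omega gamma : R).
Let f := average f_.
Let state := (borel_rV R d * borel_rV R d)%type.

Let eta := gamma / n%:R.
Let c := gamma * L ^+ 2 / alpha.

Definition lyapunov (z : state) : R :=
  f z.1 - fstar + c * enorm (z.2 - z.1 : 'rV[R]_d) ^+ 2.

(* A state [(x, w)] is followed by the point [p] reached so far on the way from
   [x] to the next iterate; the majorant of the Lyapunov function after the server
   step is quadratic in [p]. *)
Definition majorant (m : state * borel_rV R d) : R :=
  f m.1.1 - fstar + dot (grad f m.1.1) (m.2 - m.1.1 : 'rV[R]_d)
  + L / 2 * enorm (m.2 - m.1.1 : 'rV[R]_d) ^+ 2
  + c * ((1 - alpha) * enorm (m.2 - m.1.2 : 'rV[R]_d) ^+ 2).

(* Bounds the expected next value of the Lyapunov function when the workers in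
   [s] have not yet been added to [m]. *)
Definition potential (s : seq 'I_n) (m : state * borel_rV R d) : R :=
  majorant (m.1, m.2 - eta *: \sum_(i <- s) grad (f_ i) m.1.2)
  + (L / 2 + c * (1 - alpha)) * eta ^+ 2 * omega
    * \sum_(i <- s) enorm (grad (f_ i) m.1.2) ^+ 2.

Definition worker_step (i : 'I_n) (Y : Type) (C : Y -> 'rV[R]_d -> 'rV[R]_d)
    (q : state * borel_rV R d * Y) : state * borel_rV R d :=
  (q.1.1, q.1.2 - eta *: C q.2 (grad (f_ i) q.1.1.2)).

Definition server_step (Y : Type) (C : Y -> 'rV[R]_d -> 'rV[R]_d)
    (q : state * borel_rV R d * Y) : state :=
  (q.1.2, q.1.1.2 + C q.2 (q.1.2 - q.1.1.2)).

Hypothesis n_gt0 : (0 < n)%N.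
Hypothesis L_gt0 : 0 < L.
Hypothesis f_smooth : smooth L f.
Hypothesis f_i_smooth : forall i, exists2 Li, 0 <= Li & smooth Li (f_ i).
Hypothesis f_ge : forall x, fstar <= f x.
Hypothesis growth : forall x,
  n%:R^-1 * \sum_(i < n) enorm (grad (f_ i) x) ^+ 2 <= D * enorm (grad f x) ^+ 2.
Hypothesis D_gt0 : 0 < D.
Hypothesis alpha_gt0 : 0 < alpha.
Hypothesis alpha_le1 : alpha <= 1.
Hypothesis omega_ge0 : 0 <= omega.
Hypothesis gamma_gt0 : 0 < gamma.
Hypothesis gamma_le_alpha : gamma * (8 * L) <= alpha.
Hypothesis gamma_le_n : gamma * (4 * D * omega * L) <= n%:R.

Let c_ge0 : 0 <= c.
Proof. by rewrite /c divr_ge0 ?ltW// mulr_gt0// exprn_gt0. Qed.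

Let kappa_ge0 : 0 <= L / 2 + c * (1 - alpha).
Proof. by rewrite addr_ge0//; [rewrite divr_ge0// ltW|rewrite mulr_ge0// subr_ge0]. Qed.

(** * Pointwise inequalities for the Lyapunov function *)

Lemma lyapunov_ge0 z : 0 <= lyapunov z.
Proof. by rewrite /lyapunov addr_ge0 ?subr_ge0// mulr_ge0// sqr_ge0. Qed.

Lemma le_majorant m :
  f m.2 - fstar + c * ((1 - alpha) * enorm (m.2 - m.1.2 : 'rV[R]_d) ^+ 2) <= majorant m.
Proof.
rewrite /majorant lerD2r.
by have := smooth_upper_bound m.1.1 m.2 (ltW L_gt0) f_smooth; lra.
Qed.

(** Despite its linear term, the quadratic is nonnegative because it dominates a nonnegative
    function; this is what makes Tonelli applicable to the micro-steps. *)
Lemma majorant_ge0 m : 0 <= majorant m.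
Proof.
apply: le_trans (le_majorant m).
by rewrite addr_ge0 ?subr_ge0// mulr_ge0// mulr_ge0 ?subr_ge0// sqr_ge0.
Qed.

Lemma potential_ge0 s m : 0 <= potential s m.
Proof.
rewrite /potential addr_ge0 ?majorant_ge0// mulr_ge0//.
  by rewrite mulr_ge0// mulr_ge0// sqr_ge0.
by apply: sumr_ge0 => i _; rewrite sqr_ge0.
Qed.

Let differentiable_f_i i x : differentiable (f_ i) x.
Proof. by have [Li _ []] := f_i_smooth i. Qed.

Lemma sum_grad_sqr_le v :
  \sum_(i <- enum 'I_n) enorm (grad (f_ i) v) ^+ 2 <= n%:R * D * enorm (grad f v) ^+ 2.
Proof.
have n0 : 0 < n%:R :> R by rewrite ltr0n.
by rewrite big_enum /= -mulrA -ler_pdivrMl.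
Qed.

(** With every worker pending at [x], the mean step is exactly [gamma *: grad f v]. Expanding in
    inner products reduces the claim to [lyapunov_decrease_scalar]. *)
Lemma potential_decrease (x v : 'rV[R]_d) :
  potential (enum 'I_n) ((x, v), x) + gamma / 2 * enorm (grad f x) ^+ 2
    <= lyapunov (x, v).
Proof.
have n0 : 0 < n%:R :> R by rewrite ltr0n.
rewrite /potential /majorant /lyapunov /=.
have -> : eta *: \sum_(i <- enum 'I_n) grad (f_ i) v = gamma *: grad f v.
  by rewrite big_enum /= grad_average// scalerA.
set G := \sum_(i <- _) _.
have hG : G <= n%:R * D * enorm (grad f v) ^+ 2 by exact: sum_grad_sqr_le.
have lipf : enorm (grad f x - grad f v) ^+ 2 <= L ^+ 2 * enorm (v - x) ^+ 2.
  have -> : enorm (v - x) ^+ 2 = enorm (x - v) ^+ 2.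
    by rewrite !enorm_sqr !dotE [dot v x]dotC; ring.
  rewrite -exprMn lerXn2r ?nnegrE ?enorm_ge0 ?mulr_ge0 ?enorm_ge0 ?(ltW L_gt0)//.
  by case: f_smooth.
pose del := gamma / alpha.
have del0 : 0 < del by rewrite divr_gt0.
have gE : gamma = alpha * del by rewrite mulrC divfK ?gt_eqF.
have cE : c = del * L ^+ 2 by rewrite /c /del; field; rewrite gt_eqF.
have q8 : del * L <= 8^-1 by exact: stepsize_ratio.
pose r := omega * D / n%:R.
have r0 : 0 <= r by rewrite divr_ge0 ?mulr_ge0// ltW.
have w4 : alpha * del * L * r <= 4^-1 by rewrite -gE; exact: variance_ratio.
have hvar : (L / 2 + c * (1 - alpha)) * eta ^+ 2 * omega * G <=
    (L / 2 + c * (1 - alpha)) * gamma ^+ 2 * r * enorm (grad f v) ^+ 2.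
  apply: le_trans (ler_wpM2l _ hG) _; first by rewrite mulr_ge0// mulr_ge0// sqr_ge0.
  by rewrite /eta /r le_eqVlt; apply/orP; left; apply/eqP; field; rewrite gt_eqF.
(* The weight [2 * del] yields the form of Young's inequality used in the scalar lemma. *)
have young := dotvv_ge0 ((v - x) - (2 * del) *: grad f v).
have -> : x - gamma *: grad f v - x = - (gamma *: grad f v) by rewrite addrAC subrr add0r.
have -> : x - gamma *: grad f v - v = - (v - x + gamma *: grad f v).
  by rewrite opprD opprB addrAC.
move: lipf hvar young; set V := _ * G.
move: (grad f v) (grad f x) (v - x) => g a y.
rewrite !enorm_sqr !dotE [dot g a]dotC [dot g y]dotC.
have := dotvv_ge0 g; have := dotvv_ge0 y.
rewrite cE gE => yy0 gg0 lip var young.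
have := @lyapunov_decrease_scalar R alpha del L r V (dot a a) (dot y y) (dot g g)
  (dot a g) (dot y g) alpha_gt0 alpha_le1 del0 L_gt0 r0 q8 w4 yy0 gg0.
lra.
Qed.

(** * Measurability of the potentials and of the steps *)

Lemma measurable_grad_f :
  measurable_fun [set: borel_rV R d] (grad f : borel_rV R d -> borel_rV R d).
Proof. exact: smooth_measurable_grad (ltW L_gt0) f_smooth. Qed.

Lemma measurable_grad_f_i i :
  measurable_fun [set: borel_rV R d] (grad (f_ i) : borel_rV R d -> borel_rV R d).
Proof. by have [Li Li0 sLi] := f_i_smooth i; exact: smooth_measurable_grad sLi. Qed.

Lemma measurable_lyapunov : measurable_fun [set: state] lyapunov.
Proof.
apply: measurable_funD.
  apply: measurable_funB => //.
  exact: (measurableT_comp (smooth_measurable f_smooth) measurable_fst).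
apply: measurable_funM => //; apply: measurable_fun_enorm2.
by apply: measurable_fun_subv; [exact: measurable_snd|exact: measurable_fst].
Qed.

Lemma measurable_majorant : measurable_fun [set: state * borel_rV R d] majorant.
Proof.
have m11 : measurable_fun [set: state * borel_rV R d] (fun m => m.1.1).
  exact: (measurableT_comp measurable_fst measurable_fst).
have m12 : measurable_fun [set: state * borel_rV R d] (fun m => m.1.2).
  exact: (measurableT_comp measurable_snd measurable_fst).
have m2 : measurable_fun [set: state * borel_rV R d] snd by exact: measurable_snd.
apply: measurable_funD; last first.
  apply: measurable_funM => //; apply: measurable_funM => //.
  by apply: measurable_fun_enorm2; exact: measurable_fun_subv.
apply: measurable_funD; last first.
  apply: measurable_funM => //.
  by apply: measurable_fun_enorm2; exact: measurable_fun_subv.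
apply: measurable_funD.
  apply: measurable_funB => //.
  exact: (measurableT_comp (smooth_measurable f_smooth) m11).
apply: measurable_fun_dot; last exact: measurable_fun_subv.
exact: (measurableT_comp measurable_grad_f m11).
Qed.

Lemma measurable_potential s : measurable_fun [set: state * borel_rV R d] (potential s).
Proof.
have m12 : measurable_fun [set: state * borel_rV R d] (fun m => m.1.2).
  exact: (measurableT_comp measurable_snd measurable_fst).
have mg i : measurable_fun [set: state * borel_rV R d]
    (fun m => grad (f_ i) m.1.2 : borel_rV R d).
  exact: (measurableT_comp (measurable_grad_f_i i) m12).
apply: measurable_funD.
  apply: (measurableT_comp measurable_majorant).
  apply: measurable_fun_pair; first exact: measurable_fst.
  apply: measurable_fun_subv; first exact: measurable_snd.
  by apply: measurable_fun_scalev; exact: measurable_fun_sumv.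
apply: measurable_funM => //.
by apply: measurable_sum => i; exact: measurable_fun_enorm2.
Qed.

Lemma measurable_worker_step i (C : stoch_map R d) :
  measurable_fun [set: state * borel_rV R d * seed C] (worker_step i C).
Proof.
have m11 : measurable_fun [set: state * borel_rV R d * seed C] (fun q => q.1.1).
  exact: (measurableT_comp measurable_fst measurable_fst).
have m12 : measurable_fun [set: state * borel_rV R d * seed C] (fun q => q.1.2).
  exact: (measurableT_comp measurable_snd measurable_fst).
have m112 : measurable_fun [set: state * borel_rV R d * seed C] (fun q => q.1.1.2).
  exact: (measurableT_comp measurable_snd m11).
apply: measurable_fun_pair => //.
apply: measurable_fun_subv => //; apply: measurable_fun_scalev.
have mp : measurable_fun [set: state * borel_rV R d * seed C]
    (fun q => (q.2, grad (f_ i) q.1.1.2 : borel_rV R d)).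
  apply: measurable_fun_pair; first exact: measurable_snd.
  exact: (measurableT_comp (measurable_grad_f_i i) m112).
exact: (measurableT_comp (@stoch_fun_measurable _ _ C) mp).
Qed.

Lemma measurable_server_step (C : stoch_map R d) :
  measurable_fun [set: state * borel_rV R d * seed C] (server_step C).
Proof.
have m11 : measurable_fun [set: state * borel_rV R d * seed C] (fun q => q.1.1).
  exact: (measurableT_comp measurable_fst measurable_fst).
have m12 : measurable_fun [set: state * borel_rV R d * seed C] (fun q => q.1.2).
  exact: (measurableT_comp measurable_snd measurable_fst).
have m112 : measurable_fun [set: state * borel_rV R d * seed C] (fun q => q.1.1.2).
  exact: (measurableT_comp measurable_snd m11).
apply: measurable_fun_pair => //.
apply: measurable_fun_addv => //.
have mp : measurable_fun [set: state * borel_rV R d * seed C]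
    (fun q => (q.2, (q.1.2 : 'rV[R]_d) - q.1.1.2 : borel_rV R d)).
  apply: measurable_fun_pair; first exact: measurable_snd.
  exact: measurable_fun_subv.
exact: (measurableT_comp (@stoch_fun_measurable _ _ C) mp).
Qed.

(** * Averaging over one seed at a frozen state *)

Lemma server_step_expectation (C : stoch_map R d) m : biased_compressor alpha C ->
  (\int[seed_law C]_y (lyapunov (server_step C (m, y)))%:E
    <= (potential [::] m)%:E)%E.
Proof.
move=> Cb; have A0 : 0 <= f m.2 - fstar by rewrite subr_ge0.
have := biased_second_moment (m.2 - m.1.2 : 'rV[R]_d) Cb A0 c_ge0.
(* The new shift minus the new iterate is exactly the compression error of [p - w], where [p] is the
   point reached. *)
have E y : f m.2 - fstar
    + c * enorm (C y (m.2 - m.1.2 : 'rV[R]_d) - (m.2 - m.1.2 : 'rV[R]_d)) ^+ 2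
    = lyapunov (server_step C (m, y)).
  rewrite /lyapunov /server_step /=; congr (_ + c * enorm _ ^+ 2).
  by apply/rowP => j; rewrite !mxE; ring.
under eq_integral do rewrite E.
move=> /le_trans; apply; rewrite lee_fin /potential !big_nil scaler0 subr0 mulr0 addr0.
by case: m {A0 E} => z p; exact: (le_majorant (z, p)).
Qed.

Lemma worker_step_expectation (C : stoch_map R d) i s m : unbiased_compressor omega C ->
  (\int[seed_law C]_y (potential s (worker_step i C (m, y)))%:E
    <= (potential (i :: s) m)%:E)%E.
Proof.
move=> Cu; case: m => -[x v] p.
set a := grad (f_ i) v; set S := \sum_(j <- s) grad (f_ j) v.
set V := \sum_(j <- s) enorm (grad (f_ j) v) ^+ 2.
(* At [b] the message of worker [i] is replaced by its mean [a]. With [e] the compression error, the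
   majorant at [b - eta *: e] has linear coefficient [g] and quadratic coefficient [k * eta ^+ 2] in
   [e]. *)
pose b : 'rV[R]_d := p - eta *: (a + S).
pose k := L / 2 + c * (1 - alpha).
pose g : 'rV[R]_d :=
  - eta *: (grad f x + L *: (b - x) + (2 * c * (1 - alpha)) *: (b - v)).
pose A := majorant ((x, v), b) + k * eta ^+ 2 * omega * V.
have B0 : 0 <= k * eta ^+ 2 by rewrite mulr_ge0// sqr_ge0.
have := unbiased_second_moment a g A Cu B0.
have E y : A + dot g (C y a - a) + k * eta ^+ 2 * enorm (C y a - a) ^+ 2
    = potential s (worker_step i C ((x, v, p), y)).
  rewrite /potential /worker_step /= -/S -/V -/k /A /majorant /=.
  have -> : p - eta *: C y a - eta *: S = b - eta *: (C y a - a).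
    by rewrite /b scalerDr scalerBr !opprD opprK; apply/rowP => j; rewrite !mxE; ring.
  rewrite /g; move: (C y a - a) => e.
  have -> : b - eta *: e - x = (b - x) - eta *: e by rewrite addrAC.
  have -> : b - eta *: e - v = (b - v) - eta *: e by rewrite addrAC.
  move: (b - x) (b - v) (grad f x) => bx bv gx.
  rewrite /k !enorm_sqr !dotE.
  rewrite [dot e bx]dotC [dot e bv]dotC.
  by field.
under eq_integral do rewrite E.
move=> /le_trans; apply; rewrite lee_fin /potential /= !big_cons -/a -/S -/V -/b /A -/k.
lra.
Qed.

(** * The algorithm as a chain of micro-steps *)

Context (disp : measure_display) (Omega : measurableType disp).
Context (P : probability Omega R).
Context (CD : 'I_n -> stoch_map R d) (CP : stoch_map R d).
Context (xiD : forall i : 'I_n, nat -> {RV P >-> seed (CD i)}).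
Context (xiP : nat -> {RV P >-> seed CP}) (x0 : 'rV[R]_d).
Hypothesis CD_unbiased : forall i, unbiased_compressor omega (CD i).
Hypothesis CP_biased : biased_compressor alpha CP.
Hypothesis seeds : fresh_seeds xiD xiP.

Let st (t : nat) (w : Omega) : state := ef21p_dcgd xiD xiP f_ gamma x0 t w.

(* The state in the middle of iteration [t], after the workers in [s] have
   contributed to the descent step. *)
Definition micro_state (t : nat) (s : seq 'I_n) (w : Omega) : state * borel_rV R d :=
  (st t w, (st t w).1 -
    eta *: \sum_(i <- s) CD i (xiD i t w) (grad (f_ i) (st t w).2)).

Lemma micro_state_rcons t s i : micro_state t (rcons s i) =
  fun w => worker_step i (CD i) (micro_state t s w, xiD i t w).
Proof.
apply/funext => w; rewrite /micro_state /worker_step /= big_rcons /=.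
by rewrite scalerDr opprD addrA.
Qed.

Lemma state_succ t : st t.+1 =
  fun w => server_step CP (micro_state t (enum 'I_n) w, xiP t w).
Proof.
apply/funext => w; rewrite /micro_state /server_step /st /=.
case: (ef21p_dcgd _ _ _ _ _ _ _) => x v /=.
by rewrite big_enum /= scalerA.
Qed.

Lemma micro_state_nil t : micro_state t [::] = fun w => (st t w, (st t w).1).
Proof.
by apply/funext => w; rewrite /micro_state big_nil scaler0 subr0.
Qed.

(** Conditional on the state at [t], since the induction on [t] passes through the micro-states of
    each iteration. *)
Lemma measurable_micro_state_of t s : measurable_fun [set: Omega] (st t) ->
  measurable_fun [set: Omega] (micro_state t s).
Proof.
move=> mst; elim/last_ind: s => [|s i mM].
  rewrite micro_state_nil; apply: measurable_fun_pair => //.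
  exact: (measurableT_comp measurable_fst mst).
rewrite micro_state_rcons.
have mp : measurable_fun [set: Omega] (fun w => (micro_state t s w, xiD i t w)).
  exact: measurable_fun_pair.
exact: (measurableT_comp (measurable_worker_step i (C := CD i)) mp).
Qed.

Lemma measurable_state t : measurable_fun [set: Omega] (st t).
Proof.
elim: t => [|t mst]; first exact: measurable_cst.
rewrite state_succ.
have mM := measurable_micro_state_of (enum 'I_n) mst.
have mp : measurable_fun [set: Omega]
    (fun w => (micro_state t (enum 'I_n) w, xiP t w)).
  exact: measurable_fun_pair.
exact: (measurableT_comp (measurable_server_step (C := CP)) mp).
Qed.

Lemma measurable_micro_state t s : measurable_fun [set: Omega] (micro_state t s).
Proof. exact/measurable_micro_state_of/measurable_state. Qed.

HB.instance Definition _ t s :=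
  isMeasurableFun.Build _ _ _ _ (micro_state t s) (measurable_micro_state t s).

(** * Independence of the micro-states from the later seeds *)

Definition used_seeds (t : nat) (s : seq 'I_n) (k : 'I_n * nat + nat) : bool :=
  match k with
  | inl (i, u) => (u < t)%N || (u == t) && (i \in s)
  | inr u => (u < t)%N
  end.

Lemma seed_events_measurable k A : seed_events xiD xiP k A -> measurable A.
Proof.
by case: k => [[i u]|u] [B mB <-]; apply: measurableI => //;
  rewrite -[X in measurable X]setTI; apply: measurable_funPT.
Qed.

Lemma seed_events_worker i t B : measurable B ->
  seed_events xiD xiP (inl (i, t)) (xiD i t @^-1` B).
Proof. by move=> mB; exists B => //; rewrite setTI. Qed.

Lemma seed_events_server t B : measurable B ->
  seed_events xiD xiP (inr t) (xiP t @^-1` B).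
Proof. by move=> mB; exists B => //; rewrite setTI. Qed.

Lemma independent_micro_state_of t s :
  independent_outside P (seed_events xiD xiP) (used_seeds t [::]) (st t) ->
  uniq s ->
  independent_outside P (seed_events xiD xiP) (used_seeds t s) (micro_state t s).
Proof.
move=> ist; elim/last_ind: s => [_|s i ih].
  move=> A r E mA; rewrite micro_state_nil.
  have mg : measurable_fun [set: state] (fun z => (z, z.1)).
    by apply: measurable_fun_pair => //; exact: measurable_fst.
  have mgA : measurable ((fun z : state => (z, z.1)) @^-1` A).
    by rewrite -[X in measurable X]setTI; exact: mg.
  by have := ist _ r E mgA.
rewrite rcons_uniq => /andP[i_s us].
have i_fresh : ~~ used_seeds t s (inl (i, t)) by rewrite /= ltnn eqxx.
have := independent_outside_step seed_events_measurable (ih us) i_fresh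
  (@seed_events_worker i t) (measurable_worker_step i (C := CD i)).
(* Enlarging the set of used seeds weakens the claim, so an inclusion between the two sets
   suffices. *)
rewrite micro_state_rcons => h A r E mA ur rU; apply: h => // k /rU.
apply: contra => /= /predU1P[->|]; first by rewrite /= eqxx mem_rcons mem_head orbT.
case: k => [[j u]|//] /= /orP[->//|/andP[-> js]].
by rewrite mem_rcons inE js !orbT.
Qed.

Lemma independent_state t :
  independent_outside P (seed_events xiD xiP) (used_seeds t [::]) (st t).
Proof.
have [_ _ indep] := seeds.
elim: t => [|t ist].
  move=> A r E mA ur _ rE.
  exact: (independent_outside_cst ((x0, x0) : state) indep).
have iM := independent_micro_state_of ist (enum_uniq 'I_n).
have P_fresh : ~~ used_seeds t (enum 'I_n) (inr t) by rewrite /= ltnn.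
have := independent_outside_step seed_events_measurable iM P_fresh
  (@seed_events_server t) (measurable_server_step (C := CP)).
rewrite state_succ => h A r E mA ur rU; apply: h => // k /rU.
apply: contra => /= /predU1P[->|]; first by rewrite /= ltnSn.
case: k => [[j u]|u] /=.
  by case/orP => [/ltnW|/andP[/eqP ->]]; rewrite ltnS ?leqnn// => ->.
by move=> /ltnW; rewrite ltnS.
Qed.

Lemma independent_micro_state t s : uniq s ->
  independent_outside P (seed_events xiD xiP) (used_seeds t s) (micro_state t s).
Proof. exact/independent_micro_state_of/independent_state. Qed.

(** * Expected decrease and telescoping *)

Lemma le_integral_worker t s i s' : uniq (rcons s i) ->
  (\int[P]_w (potential s' (micro_state t (rcons s i) w))%:E
    <= \int[P]_w (potential (i :: s') (micro_state t s w))%:E)%E.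
Proof.
rewrite rcons_uniq => /andP[i_s us]; rewrite micro_state_rcons.
have i_fresh : ~~ used_seeds t s (inl (i, t)) by rewrite /= ltnn eqxx.
have [lawD _ _] := seeds.
apply: (le_integral_fresh_seed seed_events_measurable
  (independent_micro_state us) i_fresh (@seed_events_worker i t)
  (law := seed_law (CD i))
  (h := fun q => (potential s' (worker_step i (CD i) q))%:E)
  (g := fun m => (potential (i :: s') m)%:E)).
- exact: lawD.
- apply/measurable_EFinP.
  exact: (measurableT_comp (measurable_potential s')
    (measurable_worker_step i (C := CD i))).
- by move=> q; rewrite lee_fin potential_ge0.
- by apply/measurable_EFinP; exact: measurable_potential.
- by move=> m; exact: worker_step_expectation.
Qed.

(** Workers pass one by one from the pending list [s'] to the list [s] of those already added. *)
Lemma le_integral_workers t s s' : uniq (s ++ s') ->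
  (\int[P]_w (potential [::] (micro_state t (s ++ s') w))%:E
    <= \int[P]_w (potential s' (micro_state t s w))%:E)%E.
Proof.
elim: s' s => [|i s' ih] s; first by rewrite cats0.
rewrite -cat_rcons => us; apply: le_trans (ih _ us) _.
by apply: le_integral_worker; move: us; rewrite cat_uniq => /andP[].
Qed.

Lemma le_integral_server t :
  (\int[P]_w (lyapunov (st t.+1 w))%:E
    <= \int[P]_w (potential [::] (micro_state t (enum 'I_n) w))%:E)%E.
Proof.
rewrite state_succ.
have P_fresh : ~~ used_seeds t (enum 'I_n) (inr t) by rewrite /= ltnn.
have [_ lawP _] := seeds.
apply: (le_integral_fresh_seed seed_events_measurable
  (independent_micro_state (enum_uniq 'I_n)) P_fresh (@seed_events_server t)
  (law := seed_law CP)
  (h := fun q => (lyapunov (server_step CP q))%:E)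
  (g := fun m => (potential [::] m)%:E)).
- exact: lawP.
- apply/measurable_EFinP.
  exact: (measurableT_comp measurable_lyapunov (measurable_server_step (C := CP))).
- by move=> q; rewrite lee_fin lyapunov_ge0.
- by apply/measurable_EFinP; exact: measurable_potential.
- by move=> m; exact: server_step_expectation.
Qed.

Lemma expected_lyapunov_decrease t :
  (\int[P]_w (lyapunov (st t.+1 w))%:E
   + (gamma / 2)%:E * \int[P]_w (enorm (grad f (st t w).1) ^+ 2)%:E
    <= \int[P]_w (lyapunov (st t w))%:E)%E.
Proof.
have mx : measurable_fun [set: Omega] (fun w => (st t w).1).
  exact: (measurableT_comp measurable_fst (measurable_state t)).
have mg2 : measurable_fun [set: Omega] (fun w => enorm (grad f (st t w).1) ^+ 2).
  apply: measurable_fun_enorm2; exact: (measurableT_comp measurable_grad_f mx).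
have mpot : measurable_fun [set: Omega]
    (fun w => potential (enum 'I_n) (micro_state t [::] w)).
  exact: (measurableT_comp (measurable_potential _) (measurable_micro_state t [::])).
have h := @le_integral_workers t [::] (enum 'I_n) (enum_uniq 'I_n).
apply: le_trans (leeD2r _ (le_trans (le_integral_server t) h)) _.
have g2 : 0 <= gamma / 2 by rewrite divr_ge0// ltW.
have mg2E := (measurable_EFinP _ _).2 mg2.
have mpotE := (measurable_EFinP _ _).2 mpot.
have g2_ge0 (w : Omega) : setT w -> (0 <= (enorm (grad f (st t w).1) ^+ 2)%:E)%E.
  by rewrite lee_fin sqr_ge0.
have pot_ge0 (w : Omega) : setT w ->
    (0 <= (potential (enum 'I_n) (micro_state t [::] w))%:E)%E.
  by rewrite lee_fin potential_ge0.
have kg2_ge0 (w : Omega) : setT w ->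
    (0 <= (gamma / 2)%:E * (enorm (grad f (st t w).1) ^+ 2)%:E)%E.
  by move=> Tw; rewrite mule_ge0//; exact: g2_ge0.
have mkg2 := measurable_funeM (gamma / 2)%:E mg2E.
rewrite -(ge0_integralZl_EFin P measurableT g2_ge0 mg2E g2).
rewrite -(ge0_integralD P measurableT pot_ge0 mpotE kg2_ge0 mkg2).
apply: ge0_le_integral => //.
- by move=> w Tw; rewrite adde_ge0// ?pot_ge0// kg2_ge0.
- exact: emeasurable_funD.
- apply/measurable_EFinP.
  exact: (measurableT_comp measurable_lyapunov (measurable_state t)).
- move=> w _; rewrite micro_state_nil -EFinM -EFinD lee_fin.
  by case: (st t w) => x v; exact: potential_decrease.
Qed.

(** Telescoping in the extended reals: the last Lyapunov expectation stays on the left and is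
    dropped at the end, so nothing possibly infinite is subtracted. *)
Lemma expected_gradients_sum (N : nat) :
  ((gamma / 2)%:E *
    \sum_(t < N) \int[P]_w (enorm (grad f (st t w).1) ^+ 2)%:E
    <= (f x0 - fstar)%:E)%E.
Proof.
have g2 : 0 <= gamma / 2 by rewrite divr_ge0// ltW.
have G_ge0 t : (0 <= \int[P]_w (enorm (grad f (st t w).1) ^+ 2)%:E)%E.
  by apply: integral_ge0 => w _; rewrite lee_fin sqr_ge0.
have V_ge0 t : (0 <= \int[P]_w (lyapunov (st t w))%:E)%E.
  by apply: integral_ge0 => w _; rewrite lee_fin lyapunov_ge0.
suff h : (\int[P]_w (lyapunov (st N w))%:E + (gamma / 2)%:E *
    \sum_(t < N) \int[P]_w (enorm (grad f (st t w).1) ^+ 2)%:E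
    <= (f x0 - fstar)%:E)%E.
  by apply: le_trans h; rewrite leeDr.
elim: N => [|N ih].
  rewrite big_ord0 mule0 adde0.
  have -> : (f x0 - fstar)%:E = ((f x0 - fstar)%:E * P setT)%E.
    by rewrite probability_setT mule1.
  rewrite -integral_cst// le_eqVlt; apply/orP; left; apply/eqP.
  apply: eq_integral => w _; rewrite /lyapunov /st /= subrr enorm_sqr.
  by rewrite -(scale0r (0 : 'rV[R]_d)) dotZl mul0r mulr0 addr0.
rewrite big_ord_recr /= ge0_muleDr//; last by apply: sume_ge0.
apply: le_trans ih; rewrite addeCA addeC.
by apply: leeD2r; exact: expected_lyapunov_decrease.
Qed.

End lyapunov.

(** * Stepsize and number of iterations *)

(* Both cases of the minimum of fractions, with [x / 0 = +oo], amount to the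
   two multiplicative bounds together with a lower bound on [gamma]. *)
Lemma stepsizeP (R : realType) (n : nat) (L D alpha omega gamma : R) :
  (0 < n)%N -> 0 < L -> 0 < D -> 0 < alpha -> 0 <= omega ->
  stepsize (mine (frac_oo alpha (8 * L)) (frac_oo n%:R (4 * D * omega * L))) gamma ->
  [/\ 0 < gamma, gamma * (8 * L) <= alpha, gamma * (4 * D * omega * L) <= n%:R
    & 1 <= gamma * (L * Num.max (8 / alpha) (4 * D * omega / n%:R))].
Proof.
move=> n_gt0 L_gt0 D_gt0 a0 omega_ge0 [g0 gE].
have n0 : 0 < n%:R :> R by rewrite ltr0n.
have L8 : 0 < 8 * L by rewrite mulr_gt0.
move: gE; rewrite /frac_oo (gt_eqF L8).
(* For [omega = 0] the second fraction is [+oo] and the minimum is the first one. *)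
have [->|w0] := eqVneq omega 0.
  rewrite mulr0 !mul0r mulr0 eqxx.
  have -> : mine (alpha / (8 * L))%:E +oo%E = (alpha / (8 * L))%:E.
    by apply/min_idPl; rewrite leey.
  case=> // -[gE]; split => //; first by rewrite -gE divfK// gt_eqF.
  have /max_idPl -> : 0 <= 8 / alpha by rewrite divr_ge0// ltW.
  rewrite -gE le_eqVlt; apply/orP; left; apply/eqP; field.
  by rewrite !gt_eqF.
have W0 : 0 < 4 * D * omega * L.
  by rewrite mulr_gt0// mulr_gt0 ?mulr_gt0// lt_def w0.
rewrite (gt_eqF W0) -EFin_min; case=> // -[gE].
split => //.
- by rewrite -ler_pdivlMr// -gE ge_min lexx.
- by rewrite -ler_pdivlMr// -gE ge_min lexx orbT.
- have [gl|gl] := leP (alpha / (8 * L)) (n%:R / (4 * D * omega * L)).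
  + apply: (@le_trans _ _ (gamma * (L * (8 / alpha)))).
      rewrite -gE (min_idPl gl) le_eqVlt; apply/orP; left; apply/eqP; field.
      by rewrite !gt_eqF.
    by rewrite ler_pM2l// ler_pM2l// le_max lexx.
  + apply: (@le_trans _ _ (gamma * (L * (4 * D * omega / n%:R)))).
      rewrite -gE (min_idPr (ltW gl)) le_eqVlt; apply/orP; left; apply/eqP; field.
      by rewrite w0 !gt_eqF.
    by rewrite ler_pM2l// ler_pM2l// le_max lexx orbT.
Qed.

(** If the minimum exceeded [eps], the sum would be at least [T%:R * eps > a]. For [T = 0] the
    hypotheses on [a] contradict each other. *)
Lemma bigmine_le_of_sum_le (R : realType) (T : nat) (a eps : R) (E : 'I_T -> \bar R) :
  (forall t, 0 <= E t)%E -> (\sum_(t < T) E t <= a%:E)%E -> a < T%:R * eps ->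
  (\big[mine/+oo]_(t < T) E t <= eps%:E)%E.
Proof.
move=> E0 sumE aT; rewrite leNgt; apply/negP => lt_eps.
have Et t : (eps%:E <= E t)%E.
  by apply: ltW; apply: lt_le_trans lt_eps _; exact: bigmin_le.
have : (\sum_(t < T) eps%:E <= \sum_(t < T) E t)%E by apply: lee_sum.
rewrite sumEFin => /le_trans /(_ sumE).
by rewrite lee_fin sumr_const card_ord -mulr_natl leNgt aT.
Qed.

Theorem theorem6p4 (R : realType) (d n : nat) (n_gt0 : (0 < n)%N)
    (f_ : 'I_n -> 'rV[R]_d -> R) (L : R) (L_ : 'I_n -> R)
    (fstar : R) (fstar_ : 'I_n -> R) (D alpha omega eps gamma : R)
    (x0 : 'rV[R]_d) (T : nat)
    (disp : measure_display) (Omega : measurableType disp)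
    (P : probability Omega R)
    (CD : 'I_n -> stoch_map R d) (CP : stoch_map R d)
    (xiD : forall i : 'I_n, nat -> {RV P >-> seed (CD i)})
    (xiP : nat -> {RV P >-> seed CP})
    (f := average f_) (Delta0 := f x0 - fstar)
    (f_smooth : smoothness_constant f L)
    (f_i_smooth : forall i, smoothness_constant (f_ i) (L_ i))
    (f_ge : forall x, fstar <= f x)
    (f_i_ge : forall i x, fstar_ i <= f_ i x)
    (D_gt0 : 0 < D)
    (growth : forall x, n%:R^-1 * \sum_(i < n) enorm (grad (f_ i) x) ^+ 2
                        <= D * enorm (grad f x) ^+ 2)
    (eps_gt0 : 0 < eps)
    (alpha_gt0 : 0 < alpha) (alpha_le1 : alpha <= 1) (omega_ge0 : 0 <= omega)
    (CD_unbiased : forall i, unbiased_compressor omega (CD i))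
    (CP_biased : biased_compressor alpha CP)
    (seeds : fresh_seeds xiD xiP)
    (gammaE : stepsize (mine (frac_oo alpha (8 * L))
                             (frac_oo n%:R (4 * D * omega * L))) gamma)
    (T_gt0 : (0 < T)%N)
    (T_ge : 48 * Delta0 * L / eps * Num.max (8 / alpha) (4 * D * omega / n%:R)
            <= T%:R) :
  (\big[mine/+oo]_(t < T)
     'E_P[fun w => (enorm (grad f (iterate xiD xiP f_ gamma x0 t w)) ^+ 2)%R]
   <= eps%:E)%E.
Proof.
have [L_ge0 sf _] := f_smooth.
move: L_ge0; rewrite le_eqVlt => /predU1P[L0|L_gt0].
  (* For [L = 0] the gradient vanishes everywhere, so the term [t = 0] already suffices. *)
  rewrite -L0 in sf; apply: le_trans (bigmin_le _ (Ordinal T_gt0) _) _.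
  rewrite expectation.unlock.
  under eq_integral do rewrite (smooth0_bounded_grad _ sf f_ge) enorm_sqr
    -(scale0r (0 : 'rV[R]_d)) dotZl mul0r.
  by rewrite integral0 lee_fin ltW.
have [gamma_gt0 gamma_a gamma_n gamma_lb] :=
  stepsizeP n_gt0 L_gt0 D_gt0 alpha_gt0 omega_ge0 gammaE.
have sfi i : exists2 Li, 0 <= Li & smooth Li (f_ i).
  by have [? ? _] := f_i_smooth i; exists (L_ i).
have Delta0_ge0 : 0 <= Delta0 by rewrite subr_ge0.
pose G (t : 'I_T) : \bar R :=
  'E_P[fun w => (enorm (grad f (iterate xiD xiP f_ gamma x0 t w)) ^+ 2)%R]%E.
have sumG : (\sum_(t < T) G t <= (2 / gamma * Delta0)%:E)%E.
  have := expected_gradients_sum n_gt0 L_gt0 sf sfi f_ge growth D_gt0 alpha_gt0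
    alpha_le1 omega_ge0 gamma_gt0 gamma_a gamma_n x0 CD_unbiased CP_biased seeds T.
  rewrite -/Delta0 => h.
  rewrite EFinM -lee_pdivrMl ?divr_gt0// invf_div.
  by apply: le_trans h; rewrite /G expectation.unlock.
apply: (bigmine_le_of_sum_le _ sumG) => [t|].
  by rewrite /G expectation.unlock; apply: integral_ge0 => w _; rewrite lee_fin sqr_ge0.
set m := Num.max _ _ in gamma_lb T_ge.
have T0 : 0 < T%:R :> R by rewrite ltr0n.
(* The strict bound [2 / gamma * Delta0 < T%:R * eps] comes from [T > 0] when [Delta0 = 0], and from
   [2 < 48] together with [gamma^-1 <= L * m] otherwise. *)
have [D0|D0] := eqVneq Delta0 0; first by rewrite D0 mulr0 mulr_gt0.
have {D0}Dpos : 0 < Delta0 by rewrite lt_def D0.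
have T_eps : 48 * Delta0 * L * m <= T%:R * eps.
  by rewrite -ler_pdivrMr// mulrAC.
apply: lt_le_trans T_eps.
have h : gamma^-1 <= L * m by rewrite -[leLHS]mulr1 ler_pdivrMl.
have : 2 * Delta0 * gamma^-1 <= 2 * Delta0 * (L * m).
  by rewrite ler_pM2l// mulr_gt0.
have : 0 < Delta0 * (L * m).
  by rewrite mulr_gt0// (lt_le_trans _ h)// invr_gt0.
lra.
Qed.
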